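(* Let $\mathcal{X}=\{x_1,\dots,x_k\}$ be a finite set with a similarity function $s:\mathcal{X}\times\mathcal{X}\to\mathbb{R}_+$, and let $T^*(\mathcal{X},s)$ be the set of all (nonempty) valid clusters with respect to $s$. Then $T^*(\mathcal{X},s)$ is the greatest element of the partially ordered set $(\mathcal{H}(\mathcal{X},s),\subseteq)$ of valid hierarchies; that is, $T^*(\mathcal{X},s)\in\mathcal{H}(\mathcal{X},s)$ and $T\subseteq T^*(\mathcal{X},s)$ for every $T\in\mathcal{H}(\mathcal{X},s)$.
   Context: $\mathbb{R}_+=[0,\infty)$. A similarity function on $\mathcal{X}$ is a map $s:\mathcal{X}\times\mathcal{X}\to\mathbb{R}_+$ that is symmetric and satisfies $s(x,x)>s(x,y)$ for all $x\neq y$. A subset $C\subseteq\mathcal{X}$ is a valid cluster with respect to $s$ if $s(x,y)>s(x,z)$ for all $x,y\in C$ (possibly $x=y$) and all $z\in\mathcal{X}\setminus C$. A tree on $\mathcal{X}$ is a collection $T$ of nonempty subsets of $\mathcal{X}$ such that (1) for all $u,v\in T$, $u\cap v\in\{\emptyset,u,v\}$; (2) $\{x_i\}\in T$ for all $i$, and $\mathcal{X}\in T$. A valid hierarchy over $\mathcal{X}$ with respect to $s$ is a tree $T$ on $\mathcal{X}$ all of whose elements are valid clusters; $\mathcal{H}(\mathcal{X},s)$ is the set of valid hierarchies. Trees are partially ordered by inclusion: $T\subseteq T'$ iff every $t\in T$ belongs to $T'$. *)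

(* Defs.v *)
From mathcomp Require Import all_boot all_order all_algebra.
From mathcomp Require Import reals.

Set Implicit Arguments.
Unset Strict Implicit.
Unset Printing Implicit Defensive.

Import Order.TTheory GRing.Theory Num.Theory.
Local Open Scope ring_scope.

Definition similarity (R : realType) (X : finType) (s : X -> X -> R) : Prop :=
  [/\ forall x y, 0 <= s x y,
      forall x y, s x y = s y x
    & forall x y, x != y -> s x x > s x y].

(* The empty set satisfies this predicate vacuously; nonemptiness is imposed
   separately, in [tree] and [valid_clusters]. *)
Definition valid_cluster (R : realType) (X : finType) (s : X -> X -> R)
    (C : {set X}) : bool :=
  [forall x in C, forall y in C, forall z in ~: C, s x y > s x z].

Definition tree (X : finType) (T : {set {set X}}) : bool :=
  [&& set0 \notin T,
      [forall u in T, forall v in T, u :&: v \in [set set0; u; v]],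
      [forall x, [set x] \in T]
    & [set: X] \in T].

Definition valid_hierarchies (R : realType) (X : finType) (s : X -> X -> R) :
    {set {set {set X}}} :=
  [set T | tree T & [forall C in T, valid_cluster s C]].

Definition valid_clusters (R : realType) (X : finType) (s : X -> X -> R) :
    {set {set X}} :=
  [set C | C != set0 & valid_cluster s C].

(* Main.v *)
Require Import Defs.
From mathcomp Require Import all_boot all_order all_algebra.
From mathcomp Require Import reals.

(** If two valid clusters [u] and [v] share a point [x] and there are
    [a] in [u \ v] and [b] in [v \ u], then validity of [u] gives
    [s x a > s x b] while validity of [v] gives [s x b > s x a]. *)

Lemma valid_clusterP {R : realType} {X : finType} {s : X -> X -> R}
    {C : {set X}} :
  reflect (forall x y z, x \in C -> y \in C -> z \notin C ->
             (s x z < s x y)%R)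
          (valid_cluster s C).
Proof.
apply: (iffP idP) => [vC x y z xC yC zC | vC].
  move/forall_inP/(_ x xC)/forall_inP/(_ y yC)/forall_inP: vC.
  by apply; rewrite inE.
apply/forall_inP => x xC; apply/forall_inP => y yC; apply/forall_inP => z.
by rewrite inE; apply: vC.
Qed.

Lemma valid_cluster_laminar {R : realType} {X : finType} {s : X -> X -> R}
    {u v : {set X}} :
  valid_cluster s u -> valid_cluster s v -> u :&: v \in [set set0; u; v].
Proof.
move=> /valid_clusterP vu /valid_clusterP vv; rewrite !inE.
have [//|[x /setIP[xu xv]]] := set_0Vmem (u :&: v); first by move->; rewrite eqxx.
(* Nested sets meet in the smaller one. If neither inclusion holds, both differences are inhabited,
   which supplies the points [a] and [b] of the contradiction. *)
have [/setIidPl->|/subsetPn[a au aNv]] := boolP (u \subset v).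
  by rewrite eqxx orbT.
have [/setIidPr->|/subsetPn[b bv bNu]] := boolP (v \subset u).
  by rewrite eqxx !orbT.
have := Order.POrderTheory.lt_trans (vu x a b xu au bNu) (vv x b a xv bv aNv).
by rewrite Order.POrderTheory.ltxx.
Qed.

(** Both cluster points collapse to [x], so validity becomes strict dominance of self-similarity,
    [s x z < s x x] for [z != x]. *)
Lemma valid_cluster_set1 {R : realType} {X : finType} {s : X -> X -> R}
    (x : X) :
  similarity s -> valid_cluster s [set x].
Proof.
case=> _ _ s_gt; apply/valid_clusterP => ? ? z /set1P-> /set1P->.
by rewrite inE eq_sym => /s_gt.
Qed.

Lemma valid_cluster_setT {R : realType} {X : finType} (s : X -> X -> R) :
  valid_cluster s [set: X].
Proof. by apply/valid_clusterP => x y z _ _; rewrite inE. Qed.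

Theorem theorem1 (R : realType) (X : finType) (s : X -> X -> R)
    (X_nonempty : (0 < #|X|)%N) (s_sim : similarity s) :
  valid_clusters s \in valid_hierarchies s /\
  (forall T : {set {set X}},
     T \in valid_hierarchies s -> T \subset valid_clusters s).
Proof.
split=> [|T].
  rewrite inE; apply/andP; split; last first.
    by apply/forall_inP => C; rewrite inE => /andP[].
  apply/and4P; split.
  - by rewrite inE eqxx.
  - apply/forall_inP => u; rewrite inE => /andP[_ vu].
    apply/forall_inP => v; rewrite inE => /andP[_ vv].
    exact: valid_cluster_laminar vu vv.
  - apply/forallP => x; rewrite inE valid_cluster_set1 // andbT.
    by apply/set0Pn; exists x; rewrite set11.
  (* Validity of the whole space is vacuous, as no point lies outside it; [X_nonempty] makes it a
     nonempty cluster. *)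
  - by rewrite inE valid_cluster_setT andbT -card_gt0 cardsT.
(* Greatest element: members of a hierarchy are valid by definition, and nonempty because a tree
   excludes [set0]. *)
rewrite inE => /andP[/and4P[T0 _ _ _] /forall_inP vT].
apply/subsetP => C CT; rewrite inE vT // andbT.
by apply: contraNneq T0 => <-.
Qed.
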